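(* Let $k\ge2$ and let $R$ be a commutative ring with $1$. Let $X$ be a $\mathbb{Z}_k$-complex equipped with an equivariant admissible $\mathbb{Z}_k\times\mathbb{N}$-labelling $\ell$. Let $(x_i)_{0\le i\le r}$ be a generalized $r$-sphere in $C_\bullet(X)=C_\bullet(X;R)$ for some $r\ge0$. Set $$\alpha_i:=u\big(\sigma\cdot f_i(h_i^\ell(x_i))\big)\in R\qquad(0\le i\le r).$$ Then: (1) $\alpha_0$ equals the sum of the coefficients of the $0$-simplices in $x_0$ (and hence does not depend on $\ell$); (2) $\alpha_i\equiv\alpha_0\pmod k$ (i.e. modulo $kR$) for all $0\le i\le r$.
   Context: $\mathbb{Z}_k=\{e,g,\dots,g^{k-1}\}$ is the cyclic group of order $k$, written multiplicatively, with generator $g$; $\mathbb{N}$ is the set of positive integers; $\Lambda=R[\mathbb{Z}_k]$. Set $\tau=g-e$, $\sigma=e+g+\cdots+g^{k-1}$, and $\sigma_i=e+g+\cdots+g^{i-1}$ for $0\le i\le k$. The map $u\colon\Lambda\to R$ is $\sum_i\alpha_i g^i\mapsto\alpha_0$ (coefficient of $e$). A $\mathbb{Z}_k$-complex is a simplicial complex $X$ with $\mathbb{Z}_k$ acting by simplicial homeomorphisms; then $C_\bullet(X)$, the simplicial chain complex with coefficients in $R$, is a complex of $\Lambda$-modules. A labelling is a map $\ell\colon V(X)\to\mathbb{Z}_k\times\mathbb{N}$, $\ell(v)=(s,c)$ with sign $s$ and color $c$. It is admissible if the two vertices of any edge carry different colors or the same sign, and equivariant if $\ell(hv)=h\,\ell(v)$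 for all $h\in\mathbb{Z}_k$ and vertices $v$, where $h(s,c)=(hs,c)$. (An equivariant labelling can only exist if the action is free.) Generalized $r$-sphere in $C_\bullet(X)$: a sequence of chains $x_i\in C_i(X)$, $0\le i\le r$, such that for all $0<i\le r$: $\partial x_i=\sigma x_{i-1}$ if $i$ is even and $\partial x_i=\tau x_{i-1}$ if $i$ is odd. $S_r$ is the free $R$-module with basis the symbols $h_0\otimes\cdots\otimes h_r$, $h_i\in\mathbb{Z}_k$, with $\Lambda$-module structure $h\cdot(h_0\otimes\cdots\otimes h_r)=hh_0\otimes\cdots\otimes hh_r$. It has the $\Lambda$-basis $[h_1|\cdots|h_r]:=e\otimes h_1\otimes h_1h_2\otimes\cdots\otimes h_1\cdots h_r$. $h_r^\ell\colon C_r(X)\to S_r$ is the $R$-linear map sending an oriented simplex $\langle v_0,\dots,v_r\rangle$ with $\ell(v_i)=(s_i,c_i)$ to $\operatorname{sign}(\pi)\,s_{\pi(0)}\otimes\cdots\otimes s_{\pi(r)}$ if the $c_i$ are pairwise distinct, where $\pi$ is the permutation of $\{0,\dots,r\}$ with $c_{\pi(0)}<\cdots<c_{\pi(r)}$, and to $0$ otherwise. An element $h_0\otimes\cdots\otimes h_{2s}=g^{a_0}[g^{a_1}|\cdots|g^{a_{2s}}]$ with $0\le a_i<k$ is strongly alternating if $a_{2i+1}+a_{2i+2}\ge k$ for all $0\le i\le s-1$. $f_r\colon S_r\to\Lambda$ is the $\Lambda$-linear map with $f_{2s}([h_1|\cdots|h_{2s}])=e$ if $[h_1|\cdots|h_{2s}]$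 is strongly alternating and $0$ otherwise, and $f_{2s+1}([h_1|\cdots|h_{2s+1}])=\sigma_i\,f_{2s}([h_2|\cdots|h_{2s+1}])$ for $h_1=g^i$, $0\le i<k$. *)

(* Defs.v *)
From HB Require Import structures.
From mathcomp Require Import all_boot all_fingroup all_algebra.
From mathcomp Require Import finmap monalg boolp.

Set Implicit Arguments.
Unset Strict Implicit.
Unset Printing Implicit Defensive.

Import GRing.Theory.
Local Open Scope fset_scope.
Local Open Scope ring_scope.

Section FreeModule.
Variables (R : pzRingType) (K : choiceType).

(* {malg R[K]} only has a scalar multiplication when R is nontrivial. *)
Definition freemod : Type := {malg R[K]}.
HB.instance Definition _ := GRing.Zmodule.on freemod.

Definition fmscale (a : R) (x : freemod) : freemod :=
  \sum_(k <- msupp x) (<< a * x@_k *g k >> : freemod).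

Lemma fmscaleE a (x : freemod) k : (fmscale a x)@_k = a * x@_k.
Proof.
rewrite {2}[x]monalgE !raddf_sum mulr_sumr.
by apply/eq_bigr=> i _ /=; rewrite !mcoeffU mulrnAr.
Qed.

Fact fmscaleA a b x : fmscale a (fmscale b x) = fmscale (a * b) x.
Proof. by apply/malgP=> k; rewrite !fmscaleE mulrA. Qed.

Fact fmscale1 : left_id 1 fmscale.
Proof. by move=> x; apply/malgP=> k; rewrite !fmscaleE mul1r. Qed.

Fact fmscaleDr : right_distributive fmscale +%R.
Proof.
by move=> a x y; apply/malgP=> k; rewrite !(fmscaleE, mcoeffD) mulrDr.
Qed.

Fact fmscaleDl x : {morph fmscale^~ x : a b / a + b}.
Proof.
by move=> a b; apply/malgP=> k; rewrite !(fmscaleE, mcoeffD) mulrDl.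
Qed.

HB.instance Definition _ := GRing.Zmodule_isLmodule.Build R freemod
  fmscaleA fmscale1 fmscaleDr fmscaleDl.

Lemma fmcoeffZ a (x : freemod) k : (a *: x)@_k = a * x@_k.
Proof. exact: fmscaleE. Qed.

End FreeModule.

(* Locked, as are qproj and qrepr below, so that failing unifications do not *)
(* unfold the finite maps and quotients underneath.                          *)
HB.lock Definition fmbasis (R : pzRingType) (K : choiceType) (k : K) :
  freemod R K := << 1 *g k >>.

Section FreeModuleBasis.
Variables (R : pzRingType) (K : choiceType).
Local Notation freemod := (freemod R K).
Local Notation fmbasis := (@fmbasis R K).

Lemma fmcoeffB k k' : (fmbasis k)@_k' = (k == k')%:R.
Proof. by rewrite unlock mcoeffU. Qed.

Lemma fmE (x : freemod) : x = \sum_(k <- msupp x) x@_k *: fmbasis k.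
Proof.
rewrite {1}[x]monalgE; apply/eq_bigr => k _; apply/malgP => k'.
by rewrite fmcoeffZ fmcoeffB mulr_natr mcoeffU.
Qed.

Definition lext (M : lmodType R) (phi : K -> M) (x : freemod) : M :=
  \sum_(k <- msupp x) x@_k *: phi k.

Lemma lextw (M : lmodType R) (phi : K -> M) (d : {fset K}) (x : freemod) :
  msupp x `<=` d -> lext phi x = \sum_(k <- d) x@_k *: phi k.
Proof.
move=> sxd; rewrite /lext (big_fset_incl _ sxd) // => k _ /mcoeff_outdom ->.
by rewrite scale0r.
Qed.

Fact lext_is_linear (M : lmodType R) (phi : K -> M) : linear (lext phi).
Proof.
move=> a x y; set d := msupp x `|` msupp y `|` msupp (a *: x + y).
have sx : msupp x `<=` d by rewrite /d -fsetUA fsubsetUl.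
have sy : msupp y `<=` d by rewrite /d fsetUAC fsubsetUr.
rewrite (lextw _ sx) (lextw _ sy) (lextw _ (fsubsetUr _ _ : _ `<=` d)).
rewrite scaler_sumr -big_split; apply/eq_bigr => k _ /=.
by rewrite mcoeffD fmcoeffZ scalerDl scalerA.
Qed.

HB.instance Definition _ (M : lmodType R) (phi : K -> M) :=
  GRing.isLinear.Build R freemod M _ (lext phi) (lext_is_linear phi).

Lemma lextB (M : lmodType R) (phi : K -> M) k : lext phi (fmbasis k) = phi k.
Proof.
rewrite (@lextw _ _ [fset k]); last by rewrite unlock; exact: msuppU_le.
by rewrite big_seq_fset1 fmcoeffB eqxx scale1r.
Qed.

Lemma lextP (M : lmodType R) (f g : {linear freemod -> M}) :
  (forall k, f (fmbasis k) = g (fmbasis k)) -> f =1 g.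
Proof.
move=> fg x; rewrite [x]fmE !linear_sum; apply/eq_bigr => k _.
by rewrite !linearZ fg.
Qed.

End FreeModuleBasis.

Section GroupRing.
Variables (R : comPzRingType) (G : finGroupType).

Definition grpring : Type := freemod R G.
HB.instance Definition _ := GRing.Lmodule.on grpring.

Definition grmul (x y : grpring) : grpring :=
  \sum_(a : G) \sum_(b : G) (x@_a * y@_b) *: fmbasis R (a * b)%g.

Lemma grpE (x : grpring) : x = \sum_(a : G) x@_a *: (fmbasis R a : grpring).
Proof.
apply/malgP=> c; rewrite raddf_sum (bigD1 c) //= fmcoeffZ fmcoeffB eqxx mulr1.
rewrite big1 ?addr0 // => a nac.
by rewrite fmcoeffZ fmcoeffB (negbTE nac) mulr0.
Qed.

Lemma grmulE x y c : (grmul x y)@_c = \sum_(a : G) x@_a * y@_(a^-1 * c)%g.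
Proof.
rewrite raddf_sum; apply/eq_bigr => a _ /=.
rewrite raddf_sum (bigD1 (a^-1 * c)%g) //= big1 ?addr0 => [|b nb].
  by rewrite fmcoeffZ mulKVg fmcoeffB eqxx mulr1.
rewrite fmcoeffZ fmcoeffB; case: eqP => [abc|]; last by rewrite mulr0.
by rewrite -abc mulKg eqxx in nb.
Qed.

Fact grmulA : associative grmul.
Proof.
move=> x y z; apply/malgP=> c; rewrite !grmulE.
under eq_bigr do rewrite grmulE mulr_sumr.
under [RHS]eq_bigr do rewrite grmulE mulr_suml.
rewrite [RHS]exchange_big /=; apply/eq_bigr => a _.
rewrite [RHS](reindex_inj (mulgI a)); apply/eq_bigr => b _ /=.
by rewrite mulKg invMg mulgA mulrA.
Qed.

Fact grmul1 : left_id (fmbasis R 1%g) grmul.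
Proof.
move=> x; apply/malgP=> c; rewrite grmulE (bigD1 1%g) //= fmcoeffB eqxx mul1r.
rewrite invg1 mul1g big1 ?addr0 // => a na.
by rewrite fmcoeffB eq_sym (negbTE na) mul0r.
Qed.

Fact grmulr1 : right_id (fmbasis R 1%g) grmul.
Proof.
move=> x; apply/malgP=> c; rewrite grmulE (bigD1 c) //= mulVg fmcoeffB eqxx.
rewrite mulr1 big1 ?addr0 // => a na; rewrite fmcoeffB; case: eqP => [ac|].
  by rewrite -[c](mulKVg a) -ac mulg1 eqxx in na.
by rewrite mulr0.
Qed.

Fact grmulDl : left_distributive grmul +%R.
Proof.
move=> x y z; apply/malgP=> c; rewrite mcoeffD !grmulE -big_split.
by apply/eq_bigr => a _; rewrite mcoeffD mulrDl.
Qed.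

Fact grmulDr : right_distributive grmul +%R.
Proof.
move=> x y z; apply/malgP=> c; rewrite mcoeffD !grmulE -big_split.
by apply/eq_bigr => a _; rewrite mcoeffD mulrDr.
Qed.

HB.instance Definition _ := GRing.Zmodule_isPzRing.Build grpring
  grmulA grmul1 grmulr1 grmulDl grmulDr.

Definition gelt (a : G) : grpring := fmbasis R a.

Lemma geltM a b : gelt a * gelt b = gelt (a * b)%g.
Proof.
apply/malgP=> c; rewrite grmulE (bigD1 a) //= big1 ?addr0 => [|a' na].
  rewrite fmcoeffB eqxx mul1r !fmcoeffB; congr (_ *+ nat_of_bool _).
  by apply/eqP/eqP => [->|<-]; rewrite ?mulKVg ?mulKg.
by rewrite fmcoeffB eq_sym (negbTE na) mul0r.
Qed.

End GroupRing.

Section QuotientModule.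
Variables (R : pzRingType) (M : lmodType R) (I : Type) (rel : I -> M).

Definition relspan : {pred M} :=
  fun x => `[< exists s : seq (R * I), x = \sum_(e <- s) e.1 *: rel e.2 >].

Fact relspanZ a x : x \in relspan -> a *: x \in relspan.
Proof.
move=> /asboolP[s ->]; apply/asboolP; exists [seq (a * e.1, e.2) | e <- s].
by rewrite big_map scaler_sumr; apply/eq_bigr => e _; rewrite scalerA.
Qed.

Fact relspan_zmod_closed : zmod_closed relspan.
Proof.
split=> [|x y xs /(relspanZ (-1)) /asboolP[t]].
  by apply/asboolP; exists [::]; rewrite big_nil.
rewrite scaleN1r => ->; move/asboolP: xs => [s ->].
by apply/asboolP; exists (s ++ t); rewrite big_cat.
Qed.

HB.instance Definition _ :=
  GRing.isZmodClosed.Build M relspan relspan_zmod_closed.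

Definition quotmod : Type := {ideal_quot relspan}.
HB.instance Definition _ := GRing.Zmodule.on quotmod.

End QuotientModule.

HB.lock Definition qproj (R : pzRingType) (M : lmodType R) (I : Type)
    (rel : I -> M) (x : M) : quotmod rel :=
  (\pi_{ideal_quot relspan rel} x)%qT.

HB.lock Definition qrepr (R : pzRingType) (M : lmodType R) (I : Type)
    (rel : I -> M) (x : quotmod rel) : M :=
  generic_quotient.repr (x : {ideal_quot relspan rel}).

Section QuotientModuleTheory.
Variables (R : pzRingType) (M : lmodType R) (I : Type) (rel : I -> M).
Local Notation relspan := (relspan rel).
Local Notation quotmod := (quotmod rel).
Local Notation qproj := (@qproj R M I rel).
Local Notation qrepr := (@qrepr R M I rel).

Lemma qreprK : cancel qrepr qproj.
Proof. by move=> x; rewrite qproj.unlock qrepr.unlock reprK. Qed.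

Lemma qprojP x y : reflect (qproj x = qproj y) (x - y \in relspan).
Proof. by rewrite !qproj.unlock Quotient.idealrBE; apply: eqP. Qed.

Fact qproj_is_additive : zmod_morphism qproj.
Proof. by move=> x y; rewrite !qproj.unlock !piE. Qed.

HB.instance Definition _ :=
  GRing.isZmodMorphism.Build M quotmod qproj qproj_is_additive.

Definition qscale (a : R) (x : quotmod) : quotmod := qproj (a *: qrepr x).

Lemma qscaleE a x : qscale a (qproj x) = qproj (a *: x).
Proof.
by apply/qprojP; rewrite -scalerBr; apply/relspanZ/qprojP; rewrite qreprK.
Qed.

Fact qscaleA a b x : qscale a (qscale b x) = qscale (a * b) x.
Proof. by rewrite -[x]qreprK !qscaleE scalerA. Qed.

Fact qscale1 : left_id 1 qscale.
Proof. by move=> x; rewrite -[x]qreprK !qscaleE scale1r. Qed.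

Fact qscaleDr : right_distributive qscale +%R.
Proof.
move=> a x y; rewrite -[x]qreprK -[y]qreprK -raddfD !qscaleE -raddfD.
by rewrite scalerDr.
Qed.

Fact qscaleDl x : {morph qscale^~ x : a b / a + b}.
Proof.
by move=> a b; rewrite -[x]qreprK !qscaleE -raddfD scalerDl.
Qed.

HB.instance Definition _ := GRing.Zmodule_isLmodule.Build R quotmod
  qscaleA qscale1 qscaleDr qscaleDl.

Fact qproj_is_scalable : scalable qproj.
Proof. by move=> a x; rewrite -qscaleE. Qed.

HB.instance Definition _ :=
  GRing.isScalable.Build R M quotmod _ qproj qproj_is_scalable.

(* The map induced by phi; meaningful only when phi kills the relations. *)
Definition qlift (N : Type) (phi : M -> N) (x : quotmod) : N := phi (qrepr x).

Lemma qliftE (N : lmodType R) (phi : {linear M -> N}) :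
  (forall i, phi (rel i) = 0) -> forall x, qlift phi (qproj x) = phi x.
Proof.
move=> phi0 x; apply/eqP; rewrite -subr_eq0 /qlift -linearB.
have /asboolP[s ->] : qrepr (qproj x) - x \in relspan.
  by apply/qprojP; rewrite qreprK.
by rewrite linear_sum big1 // => e _; rewrite linearZ /= phi0 scaler0.
Qed.

End QuotientModuleTheory.

(* The vertex set is all of V; the empty set is not counted as a face.       *)
Record scomplex (V : choiceType) := SComplex {
  face :> pred {fset V};
  face_neq0 : ~~ face fset0;
  face_vertex : forall v, face [fset v];
  face_sub : forall A B, face A -> B `<=` A -> B != fset0 -> face B }.

(* 'Z_k is the cyclic group of order k when 1 < k; its group law is written  *)
(* multiplicatively in group scope, and g ^+ a is the ordinal a for a < k.   *)
(* Mathcomp actions are right actions, zact v h being the vertex h v; this   *)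
(* makes no difference as the group is abelian.                              *)
Record zcomplex (k : nat) (V : choiceType) := ZComplex {
  zcx :> scomplex V;
  zact : {action 'Z_k &-> V};
  zact_face : forall h A, zcx A -> zcx [fset zact v h | v in A] }.

Section OrderedSimplices.
Variables (V : choiceType) (X : scomplex V).

(* Simplices with a chosen ordering <v_0,...,v_r> of their vertices.         *)
Definition osimplex (r : nat) : Type :=
  {t : r.+1.-tuple V | uniq t && X [fset v in tval t]}.
HB.instance Definition _ r := Choice.on (osimplex r).

Fact osub_subproof m n (f : 'I_m.+1 -> 'I_n.+1) (t : osimplex n) :
  let t' := [tuple tnth (val t) (f i) | i < m.+1] in
  injective f -> uniq t' && X [fset v in tval t'].
Proof.
case: t => t /= /andP[ut Xt] injf; apply/andP; split.
  rewrite map_inj_uniq ?enum_uniq // => i j /eqP.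
  by rewrite !(tnth_nth (thead t)) nth_uniq ?size_tuple // => /eqP/val_inj/injf.
apply: (face_sub Xt).
  apply/fsubsetP => v; rewrite !inE => /mapP[i _ ->]; exact: mem_tnth.
apply/fset0Pn; exists (tnth t (f ord0)); rewrite !inE.
by apply/mapP; exists ord0; rewrite ?mem_enum.
Qed.

Definition osub m n (f : 'I_m.+1 -> 'I_n.+1) (injf : injective f)
    (t : osimplex n) : osimplex m :=
  Sub [tuple tnth (val t) (f i) | i < m.+1] (osub_subproof t injf).

Definition operm r (p : 'S_r.+1) (t : osimplex r) : osimplex r :=
  osub (@perm_inj _ p) t.

Definition oface r (i : 'I_r.+2) (t : osimplex r.+1) : osimplex r :=
  osub (@lift_inj _ i) t.

End OrderedSimplices.

Section OrderedSimplexAction.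
Variables (k : nat) (V : choiceType) (X : zcomplex k V).

Lemma zact_inj h : injective (zact X ^~ h).
Proof. by move=> v w; case: X => Y [to [inj ?]] ? /= /inj. Qed.

Lemma zactM h h' v : zact X v (h * h')%g = zact X (zact X v h) h'.
Proof. by case: X => Y [to [? toM]] ?; rewrite /= toM ?inE. Qed.

Lemma zact1 v : zact X v 1%g = v.
Proof. by apply: (@zact_inj 1%g); rewrite -zactM mulg1. Qed.

Fact oact_subproof r h (t : osimplex X r) :
  let t' := [tuple of map (zact X ^~ h) (val t)] in
  uniq t' && X [fset v in tval t'].
Proof.
case: t => t /= /andP[ut Xt]; rewrite (map_inj_uniq (@zact_inj h)) ut /=.
have := zact_face h Xt; congr (is_true (face X _)).
apply/fsetP => v; rewrite !inE; apply/imfsetP/mapP => -[w] /=; rewrite ?inE.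
  by move=> wt ->; exists w.
by move=> wt ->; exists w; rewrite //= inE.
Qed.

Definition oact r (h : 'Z_k) (t : osimplex X r) : osimplex X r :=
  Sub [tuple of map (zact X ^~ h) (val t)] (oact_subproof h t).

End OrderedSimplexAction.

Section Chains.
Variables (R : comPzRingType) (V : choiceType) (X : scomplex V).

(* Oriented chains: the free module on the ordered simplices modulo          *)
(* <v_p(0),...,v_p(r)> = sign(p) <v_0,...,v_r>.                              *)
Definition orient_rel r (e : 'S_r.+1 * osimplex X r) :
    freemod R (osimplex X r) :=
  fmbasis R (operm e.1 e.2) - (-1) ^+ e.1 *: fmbasis R e.2.

Definition chain (r : nat) : Type := quotmod (@orient_rel r).
HB.instance Definition _ r := GRing.Lmodule.on (chain r).

Definition simp r (t : osimplex X r) : chain r :=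
  qproj (@orient_rel r) (fmbasis R t).

(* The R-linear map with <t> |-> phi t, for alternating phi (see chextE). *)
Definition chext r (M : lmodType R) (phi : osimplex X r -> M)
    (x : chain r) : M :=
  qlift (lext phi) x.

Definition alternating r (M : lmodType R) (phi : osimplex X r -> M) :=
  forall p t, phi (operm p t) = (-1) ^+ p *: phi t.

Lemma simp_alternating r : alternating (@simp r).
Proof.
move=> p t; rewrite /simp -linearZ; apply/qprojP/asboolP.
by exists [:: (1, (p, t))]; rewrite big_seq1 scale1r.
Qed.

Lemma chextE r (M : lmodType R) (phi : osimplex X r -> M) :
    alternating phi ->
  linear (chext phi) /\ forall t, chext phi (simp t) = phi t.
Proof.
move=> altphi.
have E y : chext phi (qproj (@orient_rel r) y) = lext phi y.
  by apply: qliftE => -[p t]; rewrite linearB linearZ /= !lextB altphi subrr.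
split=> [a x y|t]; last by rewrite E lextB.
by rewrite -[x]qreprK -[y]qreprK -linearP !E linearP.
Qed.

Definition bdry r : chain r.+1 -> chain r :=
  chext (fun t => \sum_(i < r.+2) (-1) ^+ i *: simp (oface i t)).

Lemma bdry_alternating r : alternating
  (fun t => \sum_(i < r.+2) (-1) ^+ i *: simp (oface i t) : chain r).
Proof.
move=> p t; rewrite scaler_sumr [RHS](reindex_inj (@perm_inj _ p)) /=.
apply/eq_bigr => i _.
have pl j : p i != p (lift i j) by rewrite (inj_eq perm_inj) neq_lift.
pose f j := sval (unlift_some (pl j)).
have fE j : p (lift i j) = lift (p i) (f j).
  by rewrite /f; case: unlift_some.
have injf : injective f.
  move=> j j' ejj'; apply: (@lift_inj _ i); apply: (@perm_inj _ p).
  by rewrite !fE ejj'.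
have -> : oface i (operm p t) = operm (perm injf) (oface (p i) t).
  apply/val_inj/eq_from_tnth => j.
  by rewrite /= !tnth_mktuple permE fE.
have ep : p = lift_perm i (p i) (perm injf).
  apply/permP => j; case: (unliftP i j) => [j'|] ->.
    by rewrite lift_perm_lift permE fE.
  by rewrite lift_perm_id.
have sgE : (-1) ^+ i * (-1) ^+ perm injf = (-1) ^+ p * (-1) ^+ (p i : nat) :> R.
  have -> : odd_perm p = odd i (+) odd (p i) (+) perm injf.
    by rewrite {1}ep odd_lift_perm.
  rewrite -[(-1) ^+ i]signr_odd -[(-1) ^+ (p i : nat)]signr_odd -!signr_addb.
  by case: (odd i) (odd (p i)) (odd_perm _) => [] [] [].
by rewrite (simp_alternating (perm injf) (oface (p i) t)) !scalerA sgE.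
Qed.

Definition coefsum : chain 0 -> R := chext (fun _ => 1 : R^o).

Lemma coefsum_alternating :
  alternating (fun _ : osimplex X 0 => 1 : R^o).
Proof.
move=> p t; have -> : p = 1%g by apply/permP => i; rewrite !ord1.
by rewrite odd_perm1 scale1r.
Qed.

End Chains.

Section CyclicGroupRing.
Variables (k : nat) (R : comPzRingType).

Definition Zgen : 'Z_k := Zp1.
Local Notation Lam := (grpring R 'Z_k).

Definition tau : Lam := gelt R Zgen - 1.
Definition sigma_ (i : nat) : Lam := \sum_(j < i) gelt R (Zgen ^+ j)%g.
Definition sigma : Lam := sigma_ k.
Definition ucoef (x : Lam) : R := mcoeff 1%g x.

Definition color : Type := {c : nat | (0 < c)%N}.
Definition labelling (V : choiceType) : Type := V -> 'Z_k * color.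

Local Notation Smod r := (freemod R (r.+1.-tuple 'Z_k)).

Section Complex.
Variables (V : choiceType) (X : zcomplex k V).

Definition cact r (h : 'Z_k) : chain R X r -> chain R X r :=
  chext (fun t => simp R (oact h t)).

Definition cscale r (lam : Lam) (x : chain R X r) : chain R X r :=
  \sum_(h : 'Z_k) lam@_h *: cact h x.

Lemma cact_alternating r (h : 'Z_k) :
  alternating (fun t => simp R (oact h t) : chain R X r).
Proof.
move=> p t; rewrite -simp_alternating; congr simp.
by apply/val_inj/eq_from_tnth => i; rewrite /= !(tnth_map, tnth_mktuple).
Qed.

Definition gen_sphere (r : nat) (x : forall i, chain R X i) : Prop :=
  forall i, (i.+1 <= r)%N ->
    bdry (x i.+1) = cscale (if odd i.+1 then tau else sigma) (x i).

Variable l : labelling V.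

Definition admissible : Prop := forall v w, v != w -> X [fset v; w] ->
  (l v).2 <> (l w).2 \/ (l v).1 = (l w).1.

Definition equivariant : Prop := forall h v,
  l (zact X v h) = ((h * (l v).1)%g, (l v).2).

(* p sorts the colors of t; there is exactly one such p if the colors are    *)
(* pairwise distinct, and none otherwise.                                    *)
Definition color_sorting r (t : osimplex X r) (p : 'S_r.+1) : bool :=
  [forall i : 'I_r.+1, forall j : 'I_r.+1, (i < j)%N ==>
    (val (l (tnth (val t) (p i))).2 < val (l (tnth (val t) (p j))).2)%N].

Definition h_simp r (t : osimplex X r) : Smod r :=
  \sum_(p : 'S_r.+1 | color_sorting t p)
    (-1) ^+ p *: fmbasis R [tuple (l (tnth (val t) (p i))).1 | i < r.+1].

Lemma h_simp_alternating r : alternating (@h_simp r).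
Proof.
move=> q t; rewrite /h_simp scaler_sumr [RHS](reindex_inj (mulIg q)) /=.
have tE (p : 'S_r.+1) i :
    tnth (val (operm q t)) (p i) = tnth (val t) ((p * q)%g i).
  by rewrite tnth_mktuple permM.
apply: eq_big => [p|p _].
  by apply: eq_forallb => i; apply: eq_forallb => j; rewrite -!tE.
rewrite scalerA -signr_addb odd_permM addbCA addbb addbF; congr (_ *: _).
apply: (congr1 (@fmbasis R _)); apply: eq_from_tnth => i.
by rewrite !tnth_mktuple permM.
Qed.

Definition h_map r : chain R X r -> Smod r := chext (@h_simp r).

End Complex.

(* [h_1|...|h_r] *)
Definition bar r (b : r.-tuple 'Z_k) : r.+1.-tuple 'Z_k :=
  [tuple of 1%g :: scanl *%g 1%g b].

(* The bar coordinates: t = thead t * [h_1|...|h_r] (see unbarK). *)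
Definition unbar r (t : r.+1.-tuple 'Z_k) : r.-tuple 'Z_k :=
  [tuple of pairmap (fun a b => a^-1 * b)%g (thead t) (behead t)].

Definition tact r (h : 'Z_k) (t : r.+1.-tuple 'Z_k) : r.+1.-tuple 'Z_k :=
  [tuple of map (fun x => h * x)%g t].

Lemma unbarK r (t : r.+1.-tuple 'Z_k) : tact (thead t) (bar (unbar t)) = t.
Proof.
apply/val_inj; case/tupleP: t => h t /=; rewrite theadE mulg1; congr (_ :: _).
rewrite -{2}[h]mulg1; elim: (tval t) 1%g => //= a s IHs c.
have e : (h * (c * ((h * c)^-1 * a)))%g = a by rewrite mulgA mulKVg.
by rewrite e; congr (_ :: _); rewrite -[X in pairmap _ X s]e IHs.
Qed.

Lemma barK r h (b : r.-tuple 'Z_k) :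
  thead (tact h (bar b)) = h /\ unbar (tact h (bar b)) = b.
Proof.
have e : thead (tact h (bar b)) = (h * 1)%g by [].
split; first by rewrite e mulg1.
apply/val_inj; rewrite /= e; elim: (tval b) 1%g => //= a s IHs c.
by rewrite IHs [(h * (c * a))%g]mulgA mulKg.
Qed.

(* b = [g^a_1|...|g^a_2s] is 0-indexed, and the ordinal values of its        *)
(* entries are the exponents a_j.                                            *)
Definition strongly_alternating (b : seq 'Z_k) : bool :=
  [forall i : 'I_(size b)./2,
    (k <= nth 1%g b i.*2 + nth 1%g b i.*2.+1)%N].

Definition fbar_even (b : seq 'Z_k) : Lam :=
  if strongly_alternating b then 1 else 0.

Definition fbar (b : seq 'Z_k) : Lam :=
  if odd (size b) then sigma_ (head 1%g b) * fbar_even (behead b)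
  else fbar_even b.

Definition f_map r : Smod r -> Lam :=
  lext (fun t : r.+1.-tuple 'Z_k => gelt R (thead t) * fbar (unbar t)).

Lemma f_mapE r h (b : r.-tuple 'Z_k) :
  f_map (fmbasis R (tact h (bar b))) = gelt R h * fbar b.
Proof. by rewrite /f_map lextB; have [-> ->] := barK h b. Qed.

End CyclicGroupRing.

(* Main.v *)
Require Import Defs.
From HB Require Import structures.
From mathcomp Require Import all_boot all_fingroup all_algebra.
From mathcomp Require Import finmap monalg ring.

(** The maps f_r form a chain map from the standard resolution of Z_k (free on
    the tuples h_0 (x) ... (x) h_r) to the minimal resolution, whose modules
    are all Lambda and whose differentials are multiplication by tau in odd
    degrees and by sigma in even positive degrees.  The label maps h_r form a
    chain map from C(X) to the standard resolution.  Hence y_i = f_i(h_i(x_i))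
    turns a generalized sphere into a sequence in Lambda with
    tau y_i = tau y_(i-1) for odd i and sigma y_i = sigma y_(i-1) for even i.
    As u(sigma y) is the augmentation of y, the augmentation is unchanged in
    the even steps; in the odd ones y_i - y_(i-1) is killed by tau, so it has
    constant coefficients and its augmentation is a multiple of k.  This gives
    the congruence, and in degree 0 the composite sends every vertex to a
    group element, which has augmentation 1.

    For the chain map property of f, [altco] and [fhom] rewrite strong
    alternation and f on homogeneous tuples, where a face is the deletion of
    an entry.  Strong alternation becomes the cup power of a 2-cochain
    [carry]: carry x y z is 1 exactly when the exponents of x^-1 y and y^-1 z
    add up with a carry.  The coboundary of [kappa x y], the sum of the group
    elements met on the way from x to y (y excluded), is carry times sigma
    ([sigma_carry]); so carry is a cocycle, hence so are its cup powers
    ([altco_cocycle]), and the identities for f follow ([fhom_bdry]).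

    For the chain map property of h ([label_value_bdry]) an orientation can be
    chosen in which the colors weakly increase.  If they strictly increase,
    the simplex and all its faces are already sorted.  Otherwise two
    consecutive vertices have the same color, hence by admissibility the same
    label: the simplex goes to 0, and so do all its faces but two, which have
    equal labels and opposite signs. *)

Set Implicit Arguments.
Unset Strict Implicit.
Unset Printing Implicit Defensive.

Import GRing.Theory.
Local Open Scope ring_scope.

(** * Alternating sums over deletions *)

Section AlternatingSums.

Definition del (T : Type) (i : nat) (s : seq T) : seq T :=
  take i s ++ drop i.+1 s.

Lemma size_del (T : Type) i (s : seq T) :
  (i < size s)%N -> size (del i s) = (size s).-1.
Proof.
move=> lis; rewrite size_cat size_drop size_takel ?(ltnW lis) //.
by rewrite -[in RHS](subnKC lis).
Qed.

Lemma nth_del (T : Type) (x0 : T) i (s : seq T) j :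
  (i < size s)%N -> nth x0 (del i s) j = nth x0 s (bump i j).
Proof.
move=> lis; rewrite nth_cat size_takel ?(ltnW lis) // /bump.
case: ltnP => [lji|lij]; first by rewrite nth_take.
by rewrite nth_drop /= addSn subnKC.
Qed.

Variables (R : comPzRingType) (M : lmodType R) (T : Type).
Implicit Types (phi : seq T -> M) (s : seq T).

Definition altsum phi s : M := \sum_(i < size s) (-1) ^+ i *: phi (del i s).

(** Splitting off the deletion of the head leaves an alternating sum of the
    same kind on the tail, so that identities on faces go by induction. *)
Lemma altsum_cons phi x s :
  altsum phi (x :: s) = phi s - altsum (fun v => phi (x :: v)) s.
Proof.
rewrite /altsum big_ord_recl scale1r /del take0 drop1 -sumrN; congr (_ + _).
by apply: eq_bigr => i _; rewrite lift0 exprS mulN1r scaleNr.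
Qed.

Lemma altsum_nil phi : altsum phi [::] = 0.
Proof. by rewrite /altsum big_ord0. Qed.

Lemma eq_altsum phi psi s :
  (forall v, size v = (size s).-1 -> phi v = psi v) ->
  altsum phi s = altsum psi s.
Proof.
by move=> e; apply: eq_bigr => i _; rewrite e // size_del.
Qed.

Lemma altsumZ (a : R) phi s :
  altsum (fun v => a *: phi v) s = a *: altsum phi s.
Proof.
rewrite /altsum scaler_sumr; apply: eq_bigr => i _.
by rewrite !scalerA mulrC.
Qed.

End AlternatingSums.

Lemma altsumZl (R : comPzRingType) (T : Type) (M : lmodType R)
    (phi : seq T -> R^o) (m : M) s :
  altsum (fun v => phi v *: m) s = altsum phi s *: m.
Proof.
by rewrite /altsum scaler_suml; apply: eq_bigr => i _; rewrite scalerA.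
Qed.

(** * The group ring and its augmentation *)

Section GroupRingTheory.
Variables (R : comPzRingType) (G : finGroupType).
Local Notation Lam := (grpring R G).
Implicit Types (x y : Lam).

Lemma grscaleAl (a : R) x y : (a *: x) * y = a *: (x * y).
Proof.
apply/malgP => c; rewrite fmcoeffZ !grmulE mulr_sumr.
by apply: eq_bigr => b _; rewrite fmcoeffZ mulrA.
Qed.

Lemma grscaleAr (a : R) x y : x * (a *: y) = a *: (x * y).
Proof.
apply/malgP => c; rewrite fmcoeffZ !grmulE mulr_sumr.
by apply: eq_bigr => b _; rewrite fmcoeffZ mulrCA.
Qed.

Lemma gelt1 : gelt R 1%g = 1 :> Lam.
Proof. by []. Qed.

Lemma gelt_coef g x c : (gelt R g * x)@_c = x@_(g^-1 * c)%g.
Proof.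
rewrite grmulE (bigD1 g) //= fmcoeffB eqxx mul1r big1 ?addr0 // => a na.
by rewrite fmcoeffB eq_sym (negbTE na) mul0r.
Qed.

Definition aug x : R := \sum_(g : G) x@_g.

Lemma aug_is_linear : linear (aug : Lam -> R^o).
Proof.
move=> a x y; rewrite /aug scaler_sumr -big_split; apply: eq_bigr => g _.
by rewrite mcoeffD fmcoeffZ.
Qed.
HB.instance Definition _ :=
  GRing.isLinear.Build R Lam R^o _ aug aug_is_linear.

Lemma aug_gelt g : aug (gelt R g) = 1.
Proof.
rewrite /aug (bigD1 g) //= fmcoeffB eqxx big1 ?addr0 // => h nh.
by rewrite fmcoeffB eq_sym (negbTE nh).
Qed.

End GroupRingTheory.

(** * Multiplication by tau and sigma for a cyclic group *)

Section CyclicTheory.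
Variables (k : nat) (R : comPzRingType).
Hypothesis hk : (1 < k)%N.
Local Notation Lam := (grpring R 'Z_k).
Local Notation sigma := (sigma k R).
Local Notation sigma_ := (sigma_ k R).
Local Notation tau := (tau k R).

Lemma Zgen_expE (a : 'Z_k) : (Zgen k ^+ a)%g = a.
Proof.
rewrite Zp_expg; apply/val_inj.
rewrite /= [(1 %% _)%N]modn_small // mul1n.
exact: modn_small.
Qed.

Lemma Zval_mul (a b : 'Z_k) : (a * b)%g = ((a + b) %% k)%N :> nat.
Proof. by rewrite -[X in (_ %% X)%N](Zp_cast hk). Qed.

Lemma sigma_coef a : sigma@_a = 1.
Proof.
have lt b : (nat_of_ord (b : 'Z_k) < k)%N.
  by rewrite -[X in (_ < X)%N](Zp_cast hk).
rewrite raddf_sum (bigD1 (Ordinal (lt a))) //= fmcoeffB Zgen_expE eqxx.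
rewrite big1 ?addr0 // => j nj; rewrite fmcoeffB; case: eqP => // eja.
case/eqP: nj; apply/val_inj; rewrite /= -eja Zp_expg /=.
by rewrite [(1 %% _)%N]modn_small // mul1n modn_small // Zp_cast.
Qed.

Lemma gelt_sigma a : gelt R a * sigma = sigma.
Proof. by apply/malgP => c; rewrite gelt_coef !sigma_coef. Qed.

Lemma sigma_gelt a : sigma * gelt R a = sigma.
Proof.
apply/malgP => c; rewrite grmulE sigma_coef -[RHS](@aug_gelt _ _ (c * a^-1)%g).
apply: eq_bigr => b _; rewrite sigma_coef mul1r !fmcoeffB.
congr (_ *+ nat_of_bool _).
by apply/eqP/eqP => [->|<-]; rewrite invMg invgK ?mulKVg ?mulgKV.
Qed.

Lemma ucoef_sigma x : ucoef (sigma * x) = aug x.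
Proof.
rewrite /ucoef grmulE /aug [RHS](reindex_inj invg_inj); apply: eq_bigr => a _.
by rewrite sigma_coef mul1r mulg1.
Qed.

(** Invariance under the generator makes all the coefficients equal. *)
Lemma tau_ker (x : Lam) : tau * x = 0 -> aug x = k%:R * x@_1%g.
Proof.
rewrite mulrBl mul1r => /eqP; rewrite subr_eq0 => /eqP e.
have xg a : x@_(Zgen k ^+ a)%g = x@_1%g.
  elim: a => // a <-; rewrite -[in LHS]e gelt_coef.
  by rewrite expgS mulKg.
rewrite /aug (eq_bigr (fun=> x@_1%g)) => [|a _]; last first.
  by rewrite -{1}(Zgen_expE a) xg.
by rewrite sumr_const card_ord Zp_cast // mulr_natl.
Qed.

Lemma aug_eq_sigma (x y : Lam) : sigma * x = sigma * y -> aug x = aug y.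
Proof. by move=> e; rewrite -!ucoef_sigma e. Qed.

Lemma aug_eq_tau (x y : Lam) :
  tau * x = tau * y -> exists c : R, aug x - aug y = k%:R * c.
Proof.
move=> e; exists ((x - y)@_1%g); rewrite -[LHS](@linearB _ _ _ _ (@aug _ _)).
by apply: tau_ker; rewrite mulrBr e subrr.
Qed.

Lemma sigma_add m n :
  sigma_ (m + n) = sigma_ m + gelt R (Zgen k ^+ m)%g * sigma_ n.
Proof.
rewrite /Defs.sigma_ big_split_ord /= mulr_sumr; congr (_ + _).
by apply: eq_bigr => j _; rewrite geltM expgD.
Qed.

(** The 2-cocycle of the extension of Z/k by Z given by the integers, in
    homogeneous form. *)
Definition carry (x y z : 'Z_k) : R :=
  (k <= (x^-1 * y)%g + (y^-1 * z)%g)%N%:R.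

(** The value of f_1 on the homogeneous tuple x (x) y: the sum of the group
    elements on the path from x to y along the powers of the generator, without
    its endpoint y. *)
Definition kappa (x y : 'Z_k) : Lam := gelt R x * sigma_ (x^-1 * y)%g.

Lemma tau_gelt a : tau * gelt R a = gelt R (a * Zgen k)%g - gelt R a.
Proof. by rewrite mulrBl mul1r geltM Zp_mulgC. Qed.

(** A telescoping sum along the path from x to y. *)
Lemma tau_kappa x y : tau * kappa x y = gelt R y - gelt R x.
Proof.
suff E n : tau * (gelt R x * sigma_ n) = gelt R (x * Zgen k ^+ n)%g - gelt R x.
  by rewrite E Zgen_expE mulKVg.
elim: n => [|n IHn].
  by rewrite /Defs.sigma_ big_ord0 !mulr0 mulg1 subrr.
have -> : gelt R x * sigma_ n.+1
        = gelt R x * sigma_ n + gelt R (x * Zgen k ^+ n)%g.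
  by rewrite /Defs.sigma_ big_ord_recr mulrDr geltM.
rewrite mulrDr [LHS](congr1 (fun z => z + _) IHn) tau_gelt -mulgA -expgSr.
by rewrite addrC subrKA.
Qed.

(** Going from x to y and on to z, instead of directly to z, makes one full
    turn around the cyclic group more exactly when there is a carry. *)
Lemma sigma_carry x y z :
  kappa y z - kappa x z + kappa x y = carry x y z *: sigma.
Proof.
have -> : kappa y z = gelt R x * (gelt R (x^-1 * y)%g * sigma_ (y^-1 * z)%g).
  by rewrite mulrA geltM mulKVg.
have exz : (x^-1 * z = (x^-1 * y) * (y^-1 * z))%g by rewrite mulgA mulgK.
rewrite /kappa /carry {}exz.
move: (x^-1 * y)%g (y^-1 * z)%g => a b.
have e : sigma_ (a + b)%N = sigma_ a + gelt R a * sigma_ b.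
  by rewrite sigma_add Zgen_expE.
rewrite addrAC [_ + gelt R x * sigma_ a]addrC -mulrDr -e -mulrBr Zval_mul.
have lt (c : 'Z_k) : (c < k)%N by rewrite -[X in (_ < X)%N](Zp_cast hk).
case: leqP => [le|ltk]; last first.
  by rewrite modn_small // subrr mulr0 scale0r.
have [n en ltn] : exists2 n, (a + b = k + n)%N & (n < k)%N.
  exists (a + b - k)%N; first by rewrite subnKC.
  by rewrite ltn_subLR // (ltn_trans (_ : _ < k + b)%N) ?ltn_add2r ?ltn_add2l.
have gk : (Zgen k ^+ k = 1)%g.
  by rewrite Zp_expg; apply/val_inj; rewrite /= !(Zp_cast hk) modnMl.
rewrite en modnDl modn_small // sigma_add gk gelt1 mul1r.
by rewrite addrK gelt_sigma scale1r.
Qed.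

(** Since carry times sigma is a coboundary, its coboundary vanishes, and the
    coefficient of the neutral element in sigma is 1. *)
Lemma carry_cocycle x y z u :
  carry y z u - carry x z u + carry x y u - carry x y z = 0.
Proof.
have [K carryE] : exists K : 'Z_k -> 'Z_k -> R,
    forall a b c, carry a b c = K b c - K a c + K a b.
  exists (fun a b => (kappa a b)@_1%g) => a b c.
  by rewrite -mcoeffB -mcoeffD sigma_carry fmcoeffZ sigma_coef mulr1.
by rewrite !carryE; ring.
Qed.

End CyclicTheory.

(** * The map f on homogeneous tuples *)

Section HomogeneousCochains.
Variables (k : nat) (R : comPzRingType).
Hypothesis hk : (1 < k)%N.
Local Notation Lam := (grpring R 'Z_k).
Local Notation sigma := (sigma k R).
Local Notation sigma_ := (sigma_ k R).
Local Notation tau := (tau k R).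
Local Notation carry := (carry R).
Local Notation kappa := (kappa R).

Local Notation barcoords x s := (pairmap (fun a b => a^-1 * b)%g x s).

Lemma strongly_alternating_cons2 (a b : 'Z_k) (s : seq 'Z_k) :
  strongly_alternating [:: a, b & s]
    = (k <= a + b)%N && strongly_alternating s.
Proof.
apply/forallP/andP => [h|[hab /forallP h] i].
  split; first exact: h ord0.
  by apply/forallP => i; apply: (h (lift ord0 i)).
case: (unliftP ord0 i) => [j|] -> //; exact: h.
Qed.

(** The value R^o, rather than R, makes it an argument of [altsum].  Tuples
    are nonempty, so that the value at the empty sequence is a dummy. *)
Definition altco (s : seq 'Z_k) : R^o :=
  if s is x :: s' then (strongly_alternating (barcoords x s'))%:R else 0.

Definition fhom (s : seq 'Z_k) : Lam :=
  if s is x :: s' then gelt R x * fbar R (barcoords x s') else 0.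

(* Otherwise simplification would expose the bar coordinates. *)
Arguments altco : simpl never.
Arguments fhom : simpl never.

Lemma altco1 x : altco [:: x] = 1.
Proof.
by rewrite /altco (_ : strongly_alternating _) //; apply/forallP => -[].
Qed.

(** This is the cup product decomposition: the last vertex z of the first
    2-simplex is the first vertex of the rest. *)
Lemma altco_cons3 x y z s :
  altco [:: x, y, z & s] = carry x y z * altco (z :: s).
Proof. by rewrite /altco /= strongly_alternating_cons2 -natrM mulnb. Qed.

Lemma fbar_evenE (b : seq 'Z_k) :
  fbar_even R b = (strongly_alternating b)%:R *: (1 : Lam).
Proof. by rewrite /fbar_even; case: ifP; rewrite ?scale1r ?scale0r. Qed.

Lemma fhom_even x s : ~~ odd (size s) ->
  fhom (x :: s) = altco (x :: s) *: gelt R x.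
Proof.
move=> /negbTE ev; rewrite /fhom /fbar size_pairmap ev fbar_evenE.
by rewrite grscaleAr mulr1.
Qed.

Lemma fhom_odd x y s : ~~ odd (size s) ->
  fhom [:: x, y & s] = altco (y :: s) *: kappa x y.
Proof.
move=> ev; rewrite /fhom /fbar /= size_pairmap ev fbar_evenE.
by rewrite grscaleAr mulr1 grscaleAr.
Qed.

(** The cocycle identity for the cup powers of carry, the face opposite to x
    standing alone on the right.  In the inductive step, the faces that keep
    x, y and z contribute, by the induction hypothesis, the one term that
    completes the cocycle identity of carry. *)
Lemma altco_cocycle x s : odd (size s) ->
  altsum (fun v => altco (x :: v)) s = altco s.
Proof.
have [n] := ubnP (size s); elim: n s x => // n IHn [|y [|z [|u s]]] x //= sn.
  by rewrite altsum_cons altsum_nil subr0 /= !altco1.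
rewrite negbK => os; rewrite 2!altsum_cons /=.
rewrite (eq_altsum (psi := fun v => carry x y z *: (altco (z :: v) : R^o)));
  last by move=> v _; exact: altco_cons3.
rewrite altsumZ IHn //; last by rewrite -ltnS ltnW.
rewrite !altco_cons3.
have /eqP := carry_cocycle R hk x y z u; rewrite subr_eq0 => /eqP <-.
move: (carry y z u) (carry x z u) (carry x y u) (altco _) => a b c d.
change (b * d - (c * d - (a - b + c) * d) = a * d); ring.
Qed.

(** The faces that keep x sum to x times the cocycle [altco], leaving the
    difference y - x, which is tau times kappa x y. *)
Lemma fhom_bdry_odd x y s : ~~ odd (size s) ->
  altsum fhom [:: x, y & s] = tau * fhom [:: x, y & s].
Proof.
move=> ev; rewrite altsum_cons fhom_odd // grscaleAr tau_kappa // scalerBr.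
rewrite fhom_even //; congr (_ - _).
rewrite -[altco _](altco_cocycle x) //.
rewrite -altsumZl; apply: eq_altsum => v /= sv.
by rewrite fhom_even // sv.
Qed.

(** The faces that keep x and y sum to kappa x y times the cocycle [altco];
    with the two others they form the coboundary of kappa. *)
Lemma fhom_bdry_even x y z s : ~~ odd (size s) ->
  altsum fhom [:: x, y, z & s] = sigma * fhom [:: x, y, z & s].
Proof.
move=> ev; rewrite fhom_even /= ?negbK // grscaleAr sigma_gelt //.
rewrite altco_cons3 mulrC -scalerA -sigma_carry //.
rewrite 2!altsum_cons !fhom_odd // scalerDr scalerBr opprB addrA.
rewrite addrAC; congr (_ + _).
rewrite -[altco _](altco_cocycle y) //.
rewrite -altsumZl; apply: eq_altsum => v /= sv.
by rewrite fhom_odd // sv.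
Qed.

(** A tuple of r+2 entries has degree r+1, whose parity selects the
    differential of the minimal resolution. *)
Lemma fhom_bdry r (s : r.+2.-tuple 'Z_k) :
  \sum_(i < r.+2) (-1) ^+ i *: fhom (del i s)
    = (if odd r.+1 then tau else sigma) * fhom s.
Proof.
have <- : altsum fhom s = \sum_(i < r.+2) (-1) ^+ i *: fhom (del i s).
  by rewrite /altsum size_tuple.
case: s => s /= /eqP; case: s => [|x [|y s]] //= [sr].
case: ifP => or; first by rewrite fhom_bdry_odd // sr.
case: s sr => [|z s] /= sr; first by rewrite -sr in or.
by rewrite fhom_bdry_even // -[odd _]negbK -/(odd (size s).+1) sr or.
Qed.

Lemma fhom_act h s : fhom [seq (h * x)%g | x <- s] = gelt R h * fhom s.
Proof.
case: s => [|x s]; first by rewrite /fhom mulr0.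
rewrite /fhom /= mulrA geltM; congr (_ * fbar R _).
elim: s x => //= y s IHs x; rewrite IHs; congr (_ :: _).
by rewrite invMg -mulgA mulKg.
Qed.

Lemma f_map_basis r (t : r.+1.-tuple 'Z_k) :
  f_map (fmbasis R t) = fhom t.
Proof. by rewrite /f_map lextB; case/tupleP: t => x t; rewrite theadE. Qed.

Lemma f_map_sum r (I : finType) (P : pred I) (a : I -> R)
    (t : I -> r.+1.-tuple 'Z_k) :
  f_map (\sum_(i | P i) a i *: fmbasis R (t i))
    = \sum_(i | P i) a i *: fhom (t i).
Proof.
rewrite {1}/f_map linear_sum; apply: eq_bigr => i _.
by rewrite linearZ -f_map_basis.
Qed.

End HomogeneousCochains.

(** * Permutations and linear maps on chains *)

Lemma perm_incr_id n (p : 'S_n) :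
  (forall i j : 'I_n, (i < j)%N -> (p i < p j)%N) -> p = 1%g.
Proof.
suff ge (q : 'S_n) (i : 'I_n) :
    (forall i j : 'I_n, (i < j)%N -> (q i < q j)%N) -> (i <= q i)%N.
  move=> incp; apply/permP => i; rewrite perm1; apply/val_inj/eqP => /=.
  (* The inverse increases too, whence the reverse inequality. *)
  rewrite eqn_leq ge // andbT -{2}[i](permK p) ge // => a b lab.
  rewrite ltnNge leq_eqVlt; apply/negP => /orP[/eqP/val_inj/perm_inj|/incp].
    by move=> eab; rewrite eab ltnn in lab.
  by rewrite !permKV ltnNge ltnW.
case: i => i; elim: i => // i IHi lti incq.
apply: leq_ltn_trans (IHi (ltnW lti) incq) _.
by apply: incq; rewrite /= ltnS.
Qed.

(** Each simplex may be given the orientation that suits it, as a change of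
    orientation multiplies both sides by the same sign. *)
Lemma chain_linear_eq (R : comPzRingType) (V : choiceType) (X : scomplex V) r
    (M : lmodType R) (f g : chain R X r -> M) :
    linear f -> linear g ->
    (forall t, exists p, f (simp R (operm p t)) = g (simp R (operm p t))) ->
  f =1 g.
Proof.
move=> linf ling efg.
have [f' ef] : exists f' : {linear chain R X r -> M}, f' =1 f.
  by exists (HB.pack_for {linear chain R X r -> M} f
    (GRing.isLinear.Build R (chain R X r) M _ f linf)).
have [g' eg] : exists g' : {linear chain R X r -> M}, g' =1 g.
  by exists (HB.pack_for {linear chain R X r -> M} g
    (GRing.isLinear.Build R (chain R X r) M _ g ling)).
have fgs t : f' (simp R t) = g' (simp R t).
  have [p] := efg t; rewrite -ef -eg simp_alternating !linearZ /=.
  move/(congr1 ( *:%R ((-1) ^+ p))); rewrite !scalerA -expr2 sqrr_sign.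
  by rewrite !scale1r.
move=> x; rewrite -ef -eg -[x]qreprK (Defs.fmE (qrepr x)).
elim: (enum_fset _) => [|t s IHs]; first by rewrite big_nil raddf0 !linear0.
rewrite big_cons linearP (linearP f') (linearP g') IHs.
by congr (_ *: _ + _); apply: fgs.
Qed.

(** * The composite of h and f is a chain map *)

Section LabellingMap.
Variables (k : nat) (R : comPzRingType) (V : choiceType) (X : zcomplex k V).
Variable (l : labelling k V).
Hypothesis hk : (1 < k)%N.
Local Notation Lam := (grpring R 'Z_k).

Definition label_value r (x : chain R X r) : Lam := f_map (h_map l x).

Lemma bdry_linear r : linear (@bdry R V X r).
Proof. exact: (proj1 (chextE (@bdry_alternating R V X r))). Qed.

Lemma h_map_linear r : linear (@h_map k R V X l r).
Proof. exact: (proj1 (chextE (@h_simp_alternating k R V X l r))). Qed.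

Lemma cact_linear r h : linear (@cact k R V X r h).
Proof. exact: (proj1 (chextE (@cact_alternating k R V X r h))). Qed.

Lemma coefsum_linear : linear (@coefsum R V X : _ -> R^o).
Proof. exact: (proj1 (chextE (@coefsum_alternating R V X))). Qed.

Fact label_value_is_linear r : linear (@label_value r).
Proof. by move=> a x y; rewrite /label_value h_map_linear /f_map linearP. Qed.

HB.instance Definition _ r :=
  GRing.isLinear.Build R (chain R X r) Lam _ (@label_value r)
    (@label_value_is_linear r).

Lemma bdry_simp r (t : osimplex X r.+1) :
  bdry (simp R t) = \sum_(i < r.+2) (-1) ^+ i *: simp R (oface i t).
Proof. exact: (proj2 (chextE (@bdry_alternating R V X r))). Qed.

Lemma coefsum_simp (t : osimplex X 0) : coefsum (simp R t) = 1.
Proof. exact: (proj2 (chextE (@coefsum_alternating R V X))). Qed.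

Lemma label_value_simp r (t : osimplex X r) : label_value (simp R t) =
  \sum_(p : 'S_r.+1 | color_sorting l t p)
    (-1) ^+ p *: fhom R [tuple (l (tnth (val t) (p i))).1 | i < r.+1].
Proof.
have h_map_simp : h_map l (simp R t) = h_simp R l t.
  exact: (proj2 (chextE (@h_simp_alternating k R V X l r))).
by rewrite /label_value h_map_simp; apply: f_map_sum.
Qed.

Lemma cact_simp r h (t : osimplex X r) :
  cact h (simp R t) = simp R (oact h t).
Proof. exact: (proj2 (chextE (@cact_alternating k R V X r h))). Qed.

Local Notation lab t i := (l (tnth (val t) i)).
Local Notation col t i := (val (lab t i).2).

Definition signs r (t : osimplex X r) : r.+1.-tuple 'Z_k :=
  [tuple (lab t i).1 | i < r.+1].

Lemma label_value_sorted r (t : osimplex X r) :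
    (forall i j : 'I_r.+1, (i < j)%N -> (col t i < col t j)%N) ->
  label_value (simp R t) = fhom R (signs t).
Proof.
move=> inct; rewrite label_value_simp (big_pred1 1%g) => [|p /=].
  rewrite odd_perm1 scale1r; congr (fhom R (tval _)).
  by apply: eq_from_tnth => i; rewrite !tnth_mktuple perm1.
apply/forallP/eqP => [h|-> i]; last first.
  by apply/forallP => j; apply/implyP => lij; rewrite !perm1 inct.
apply: perm_incr_id => i j lij.
have /forallP/(_ j)/implyP/(_ lij) lcol := h i.
rewrite ltnNge leq_eqVlt; apply/negP => /orP[/eqP/val_inj|/inct].
  by move/perm_inj => eji; rewrite eji ltnn in lij.
by rewrite ltnNge ltnW.
Qed.

Lemma label_value_repeated r (t : osimplex X r) (i j : 'I_r.+1) :
  i != j -> col t i = col t j -> label_value (simp R t) = 0.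
Proof.
move=> nij eij; rewrite label_value_simp big_pred0 // => p.
apply/negP => /forallP h.
have aux (a b : 'I_r.+1) : (a < b)%N -> col t (p a) = col t (p b) -> False.
  by move=> lab e; have /forallP/(_ b)/implyP/(_ lab) := h a; rewrite e ltnn.
have := aux (p^-1 i)%g (p^-1 j)%g; have := aux (p^-1 j)%g (p^-1 i)%g.
rewrite !permKV => h1 h2.
case: (ltngtP (p^-1 i)%g (p^-1 j)%g) => [/h2|/h1|].
- exact.
- by apply.
- by move/val_inj/perm_inj => e; rewrite e eqxx in nij.
Qed.

Lemma eq_label_value r (t t' : osimplex X r) :
    (forall i, lab t i = lab t' i) ->
  label_value (simp R t) = label_value (simp R t').
Proof.
move=> e; rewrite !label_value_simp; apply: eq_big => [p|p _].
  by apply: eq_forallb => i; apply: eq_forallb => j; rewrite !e.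
congr (_ *: fhom R (tval _)).
by apply: eq_from_tnth => i; rewrite !tnth_mktuple e.
Qed.

Lemma exists_sorting r (t : osimplex X r) : exists p : 'S_r.+1,
  forall i j : 'I_r.+1, (i <= j)%N ->
    (col (operm p t) i <= col (operm p t) j)%N.
Proof.
pose le : rel V := fun v w => (val (l v).2 <= val (l w).2)%N.
have le_tr : transitive le by move=> ? ? ?; apply: leq_trans.
have le_refl : reflexive le by move=> ?; apply: leqnn.
have le_tot : total le by move=> ? ?; apply: leq_total.
have /tuple_permP[p ep] : perm_eq (sort le (val t)) (val t).
  by rewrite perm_sort.
exists p => i j lij; pose v0 := thead (val t).
have := sorted_leq_nth le_tr le_refl v0 (sort_sorted le_tot (val t)).
move=> /(_ i j); rewrite !inE size_sort size_tuple !ltn_ord ep => /(_ _ _ lij).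
by rewrite /le -!tnth_nth; apply.
Qed.

Lemma signs_oface r (t : osimplex X r.+1) i :
  signs (oface i t) = del i (signs t) :> seq 'Z_k.
Proof.
apply: (@eq_from_nth _ 1%g) => [|j].
  by rewrite size_del ?size_tuple.
rewrite size_tuple => lj; rewrite nth_del ?size_tuple //.
rewrite -[j]/(val (Ordinal lj)) -[bump _ _]/(val (lift i (Ordinal lj))).
by rewrite -!tnth_nth !tnth_mktuple.
Qed.

Hypothesis hadm : admissible X l.

(** On a simplex ordered by weakly increasing colors, either the label map is
    compatible with all faces, or a repeated label makes both sides vanish. *)
Lemma label_value_bdry r (x : chain R X r.+1) :
  label_value (bdry x)
    = (if odd r.+1 then tau k R else sigma k R) * label_value x.
Proof.
move: x; apply: chain_linear_eq => [a x y|a x y|t].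
- by rewrite bdry_linear label_value_is_linear.
- by rewrite label_value_is_linear mulrDr grscaleAr.
have [p sortp] := exists_sorting t; exists p.
move: (operm p t) sortp => {p}t sortt.
rewrite bdry_simp [LHS]linear_sum.
under eq_bigr do rewrite linearZ /=.
have [st|] := boolP [forall i : 'I_r.+2, forall j : 'I_r.+2,
    (i < j)%N ==> (col t i < col t j)%N].
  have st' (i j : 'I_r.+2) : (i < j)%N -> (col t i < col t j)%N.
    by move/forallP/(_ i)/forallP/(_ j)/implyP: st.
  rewrite label_value_sorted // -(fhom_bdry R hk); apply: eq_bigr => i _.
  rewrite label_value_sorted ?signs_oface // => a b lab.
  rewrite !tnth_mktuple st' //= /bump.
  by rewrite -!/(bump _ _) ltnNge leq_bump2 -ltnNge.
case/forallPn => i /forallPn[j]; rewrite negb_imply -leqNgt => /andP[lij cji].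
have lim : (i.+1 < r.+2)%N by exact: leq_ltn_trans lij _.
(* The colors are squeezed between positions i and j, so consecutive positions
   i and m carry the same color. *)
pose m := Ordinal lim.
have nim : i != m by rewrite -val_eqE /= neq_ltn ltnSn.
have cim : col t i = col t m.
  apply/eqP; rewrite eqn_leq sortt ?leqnSn //=.
  by apply: leq_trans cji; apply: sortt.
have lim_eq : lab t i = lab t m.
  have : tnth (val t) i != tnth (val t) m.
    case: (t) => t' /= /andP[ut _].
    by rewrite !(tnth_nth (thead t')) nth_uniq ?size_tuple.
  case/hadm => [|c|s].
  - case: (t) => t' /= /andP[_ ft]; apply: face_sub ft _ _.
      by apply/fsubsetP => v; rewrite !inE => /orP[] /eqP ->; apply: mem_tnth.
    by apply/fset0Pn; exists (tnth t' i); rewrite !inE eqxx.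
  - by case: c; apply/val_inj.
  - by apply: injective_projections => //; apply/val_inj.
rewrite (label_value_repeated nim cim) mulr0.
(* The faces opposite to i and m cancel; every other face keeps both. *)
rewrite (bigD1 i) //= (bigD1 m) 1?eq_sym //=.
have <- : label_value (simp R (oface i t)) = label_value (simp R (oface m t)).
  apply: eq_label_value => j'.
  rewrite !tnth_mktuple; case: (eqVneq (val j') (val i)) => [e|ne].
    have -> : lift i j' = m by apply/val_inj; rewrite /= /bump -e leqnn.
    by have -> : lift m j' = i by apply/val_inj; rewrite /= /bump -e ltnn.
  congr (l (tnth _ _)); apply/val_inj; rewrite /= /bump.
  by rewrite [(i <= j')%N]leq_eqVlt eq_sym (negbTE ne).
have -> : (-1) ^+ m = - (-1) ^+ i :> R by rewrite /= exprS mulN1r.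
rewrite scaleNr addrA subrr add0r big1 // => a /andP[nai nam].
have [i' ei _] := unlift_some nai; have [m' em _] := unlift_some nam.
rewrite (@label_value_repeated _ _ i' m') ?scaler0 //.
  by apply: contraNneq nim => e; rewrite ei em e.
by rewrite !tnth_mktuple -ei -em.
Qed.

End LabellingMap.

(** * Equivariance and degree 0 *)

Section Equivariance.
Variables (k : nat) (R : comPzRingType) (V : choiceType) (X : zcomplex k V).
Variable (l : labelling k V).
Hypothesis hequi : equivariant X l.

Lemma label_value_cact r h (x : chain R X r) :
  label_value l (cact h x) = gelt R h * label_value l x.
Proof.
move: x; apply: chain_linear_eq => [a x y|a x y|t].
- by rewrite cact_linear label_value_is_linear.
- by rewrite label_value_is_linear mulrDr grscaleAr.
exists 1%g; move: (operm _ t) => {}t.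
have lab i : l (tnth (val (oact h t)) i)
    = ((h * (l (tnth (val t) i)).1)%g, (l (tnth (val t) i)).2).
  by rewrite tnth_map hequi.
rewrite cact_simp !label_value_simp mulr_sumr; apply: eq_big => [p|p _].
  by apply: eq_forallb => i; apply: eq_forallb => j; rewrite !lab.
rewrite grscaleAr -fhom_act; congr (_ *: fhom R _).
by rewrite -map_comp; apply: eq_map => i; rewrite /= lab.
Qed.

Lemma label_value_cscale r lam (x : chain R X r) :
  label_value l (cscale lam x) = lam * label_value l x.
Proof.
rewrite /cscale [LHS]linear_sum [in RHS](grpE lam) mulr_suml.
by apply: eq_bigr => h _; rewrite linearZ /= label_value_cact grscaleAl.
Qed.

End Equivariance.

Lemma aug_label_value0 (k : nat) (R : comPzRingType) (V : choiceType)
    (X : zcomplex k V) (l : labelling k V) (x : chain R X 0) :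
  aug (label_value l x) = coefsum x.
Proof.
move: x; apply: (@chain_linear_eq R V X 0 R^o) => [a x y|a x y|t].
- by rewrite label_value_is_linear aug_is_linear.
- by rewrite coefsum_linear.
exists 1%g; move: (operm _ t) => {}t.
rewrite coefsum_simp label_value_sorted => [|i j]; last by rewrite !ord1.
case/tupleP: (signs _ _) => h s; rewrite (tuple0 s) fhom_even // altco1 scale1r.
exact: aug_gelt.
Qed.

Theorem theorem5p4 (k : nat) (hk : (1 < k)%N) (R : comPzRingType)
    (V : choiceType) (X : zcomplex k V) (l : labelling k V)
    (hadm : admissible X l) (hequi : equivariant X l)
    (r : nat) (x : forall i : nat, chain R X i) (hx : gen_sphere r x) :
  let alpha (i : nat) : R := ucoef (sigma k R * f_map (h_map l (x i))) in
  alpha 0%N = coefsum (x 0%N) /\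
  (forall i : nat, (i <= r)%N ->
     exists c : R, alpha i - alpha 0%N = k%:R * c).
Proof.
move=> alpha.
have alphaE i : alpha i = aug (label_value l (x i)) by exact: ucoef_sigma.
split=> [|i]; first by rewrite alphaE aug_label_value0.
elim: i => [_|i IHi lir]; first by exists 0; rewrite subrr mulr0.
have [c ec] := IHi (ltnW lir).
have [d ed] : exists d : R, alpha i.+1 - alpha i = k%:R * d.
  rewrite !alphaE; have := congr1 (@label_value k R V X l i) (hx i lir).
  rewrite (label_value_bdry hk hadm (x i.+1)) (label_value_cscale hequi).
  case: ifP => _ eyz; first exact: aug_eq_tau eyz.
  by exists 0; rewrite (aug_eq_sigma hk eyz) subrr mulr0.
by exists (d + c); rewrite mulrDr -ed -ec addrA subrK.
Qed.
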